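(* There is a constant $c'>1$ such that for every $k\geq 5$, any deterministic distributed $\alpha$-approximation algorithm in the CONGEST model for the minimum directed $k$-spanner problem takes $\Omega\!\left(\frac{n}{\sqrt{\alpha}\cdot\log n}\right)$ rounds on some $n$-vertex input graphs, for $1\leq \alpha \leq \frac{n}{c'}$.
   Context: Directed $k$-spanner: for a directed graph $G=(V,E)$, a subgraph $H\subseteq E$ is a $k$-spanner if for every edge $(u,v)\in E$, $H$ contains a directed path of length at most $k$ from $u$ to $v$. The minimum directed $k$-spanner problem asks for a $k$-spanner with the minimum number of edges; an $\alpha$-approximation algorithm outputs a $k$-spanner of size at most $\alpha$ times the minimum. The ratio $\alpha=\alpha(n)$ may depend on $n$; it is assumed monotonically non-decreasing in $n$ and such that $n=\Theta(n')$ implies $\alpha(n)=\Theta(\alpha(n'))$. Distributed setting: the input graph is the communication network; vertices have unique IDs and initially know only their incident edges (with directions); synchronous rounds; communication is bidirectional on every edge; each vertex outputs a subset of its incident edges and the union is the spanner. In the CONGEST model each vertex may send an $O(\log n)$-bit message over each incident edge per round. *)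

(* Defs.v *)
From HB Require Import structures.
From mathcomp Require Import all_boot all_order all_algebra.
From mathcomp Require Import reals exp.

Set Implicit Arguments.
Unset Strict Implicit.
Unset Printing Implicit Defensive.

Import Order.TTheory GRing.Theory Num.Theory.
Local Open Scope ring_scope.

Definition edge_set (n : nat) := {set 'I_n * 'I_n}.

Definition is_spanner (n k : nat) (E H : edge_set n) : Prop :=
  H \subset E /\
  forall u v, (u, v) \in E ->
    exists p : seq 'I_n,
      [/\ path (fun x y => (x, y) \in H) u p, last u p = v & (size p <= k)%N].

Definition is_min_spanner (n k : nat) (E H : edge_set n) : Prop :=
  is_spanner k E H /\ forall H', is_spanner k E H' -> (#|H| <= #|H'|)%N.

Definition is_approx_spanner (R : realType) (n k : nat) (a : R)
    (E H : edge_set n) : Prop :=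
  is_spanner k E H /\
  forall Hmin, is_min_spanner k E Hmin -> #|H|%:R <= a * #|Hmin|%:R.

(* An input: a loopless digraph on n vertices with unique IDs below m.  The
   ordinal index of a vertex is never visible to an algorithm. *)
Record network (n m : nat) := Network {
  edges : edge_set n;
  vid : 'I_n -> 'I_m;
  edges_irrefl : forall v, (v, v) \notin edges;
  vid_inj : injective vid
}.

(* A set of edges incident to a given vertex, directions included: the IDs of
   the heads of the outgoing edges and of the tails of the incoming ones. *)
Definition incident (m : nat) := ({set 'I_m} * {set 'I_m})%type.

Definition incident_edges (n m : nat) (G : network n m) (v : 'I_n) :
    incident m :=
  ([set vid G u | u in [set u | (v, u) \in edges G]],
   [set vid G u | u in [set u | (u, v) \in edges G]]).

Definition adjacent (n m : nat) (G : network n m) (u v : 'I_n) : bool :=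
  ((u, v) \in edges G) || ((v, u) \in edges G).

(* A deterministic synchronous algorithm, whose vertices know the number n of
   vertices and have IDs below [ids n].  In each round, a vertex in state s
   sends the bit string [send s i] to its neighbour of ID i, and updates its
   state from the strings it receives, indexed by the ID of the sender; the
   empty string stands for silence.  A vertex may go on communicating once it
   has produced its output, but may not revise that output. *)
Record algorithm (ids : nat -> nat) := Algorithm {
  state : nat -> Type;
  init : forall n, 'I_(ids n) -> incident (ids n) -> state n;
  send : forall n, state n -> 'I_(ids n) -> seq bool;
  receive : forall n, state n -> ('I_(ids n) -> seq bool) -> state n;
  output : forall n, state n -> option (incident (ids n));
  output_final : forall n (s : state n) inbox o,
    output s = Some o -> output (receive s inbox) = Some o
}.

Section Execution.
Variables (ids : nat -> nat) (A : algorithm ids).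
Variables (n : nat) (G : network n (ids n)).

Fixpoint config (t : nat) : 'I_n -> state A n :=
  match t with
  | 0 => fun v => init A (vid G v) (incident_edges G v)
  | t'.+1 => fun v =>
      receive (config t' v) (fun i =>
        if [pick u | (vid G u == i) && adjacent G u v] is Some u
        then send (config t' u) (vid G v) else [::])
  end.

Definition all_output (t : nat) : Prop :=
  forall v, output (config t v) <> None.

Definition takes_rounds (t : nat) : Prop :=
  all_output t /\ forall t', all_output t' -> (t <= t')%N.

Definition vertex_output (t : nat) (v : 'I_n) : incident (ids n) :=
  odflt (set0, set0) (output (config t v)).

Definition outputs_incident (t : nat) : Prop :=
  forall v, (vertex_output t v).1 \subset (incident_edges G v).1 /\
            (vertex_output t v).2 \subset (incident_edges G v).2.

(* The union of the outputs of all vertices: (u, v) belongs to it if it is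
   output by its tail u or by its head v. *)
Definition output_edges (t : nat) : edge_set n :=
  [set e | (vid G e.2 \in (vertex_output t e.1).1) ||
           (vid G e.1 \in (vertex_output t e.2).2)].

End Execution.

Definition is_congest (R : realType) (ids : nat -> nat) (A : algorithm ids) :
    Prop :=
  exists (B : R) (n0 : nat), forall n, (n0 <= n)%N ->
    forall (G : network n (ids n)) (t : nat) (u v : 'I_n), adjacent G u v ->
      (size (send (config A G t u) (vid G v)))%:R <= B * ln n%:R.

Definition approximates_spanner (R : realType) (k : nat) (alpha : nat -> R)
    (ids : nat -> nat) (A : algorithm ids) : Prop :=
  forall n (G : network n (ids n)), exists t,
    [/\ takes_rounds A G t, outputs_incident A G t
      & is_approx_spanner k (alpha n) (edges G) (output_edges A G t)].

(* "n = Theta(n') implies alpha(n) = Theta(alpha(n'))" *)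
Definition theta_stable (R : realType) (alpha : nat -> R) : Prop :=
  forall c1 c2 : R, 0 < c1 -> 0 < c2 ->
  exists (d1 d2 : R) (N : nat), [/\ 0 < d1, 0 < d2
    & forall n n' : nat, (N <= n)%N -> (N <= n')%N ->
        c1 * n'%:R <= n%:R <= c2 * n'%:R ->
        d1 * alpha n' <= alpha n <= d2 * alpha n'].

Definition is_ratio (R : realType) (alpha : nat -> R) : Prop :=
  {homo alpha : m n / (m <= n)%N >-> m <= n} /\ theta_stable alpha.

(* Main.v *)
(* A spliced-execution (rectangle) argument for gap disjointness.  Alice holds
   a and Bob holds a', both subsets of [l] x [l].  In the graph built from
   (a, a'), every P i s points to every Q j t, and the only other route from
   P i s to Q j t goes through a bit edge: X1 i -> Y1 j, present when (i, j) is
   not in a, or X2 i -> Y2 j, present when (i, j) is not in a'.  If a and a' are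
   disjoint, then the O(l b + l^2) edges outside P x Q are a spanner; every
   common element (i, j) forces b^2 edges into every spanner.

   Run the algorithm on all inputs (a, ~a).  If a and c produce the same
   messages on the cut of 2 l edges, then on input (a, ~c) Alice's vertices
   behave as on (a, ~a), so the same few edges of P x Q are output; hence a \ c
   is small, and so is c \ a.  Thus each transcript belongs to inputs within a
   Hamming ball of radius l^2 / 8, which leaves 2^Omega(l^2) transcripts, and T
   rounds of O(log n)-bit messages need T l log n = Omega(l^2).  The gap is
   achieved by b ~ sqrt alpha and l ~ n / sqrt alpha. *)

Require Import Defs.
From HB Require Import structures.
From mathcomp Require Import all_boot all_order all_algebra.
From mathcomp Require Import boolp reals exp.
From mathcomp Require Import zify ring lra.
Import Order.TTheory GRing.Theory Num.Theory.
Set Implicit Arguments.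
Unset Strict Implicit.
Unset Printing Implicit Defensive.
Local Open Scope nat_scope.

(** * Counting inputs: Hamming balls and fibres *)

(** Expand [(1 + 3) ^ #|I|] as a product over [I]; [z] collects the factors that contribute 1. *)
Lemma sum_exp_card_set (I : finType) :
  \sum_(z : {set I}) 3 ^ (#|I| - #|z|) = 4 ^ #|I|.
Proof.
have := bigA_distr 1 addn (fun _ : I => 1) (fun _ : I => 3).
rewrite big_const iter_muln_1 => ->.
apply: eq_big => // z _.
rewrite (bigID (fun i => i \in z)) /= big1 ?mul1n => [|i ->//].
rewrite (eq_bigr (fun _ => 3)) => [|i /negbTE->//].
rewrite prod_nat_const -(cardsC z) addKn; congr (3 ^ _).
by apply: eq_card => i; rewrite !inE.
Qed.

(** Every [z] in the ball has weight at least [3 ^ (#|I| - r)] in the expansion of [4 ^ #|I|]. *)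
Lemma card_hamming_ball (I : finType) r (B : {set {set I}}) :
  (forall z, z \in B -> #|z| <= r) -> #|B| * 3 ^ (#|I| - r) <= 4 ^ #|I|.
Proof.
move=> Br; rewrite -sum_exp_card_set -sum_nat_const.
rewrite [leqRHS](bigID (mem B)) /=; apply: leq_trans (leq_addr _ _).
by apply: leq_sum => z /Br zr; rewrite leq_exp2l // leq_sub2l.
Qed.

Definition symdiff (I : finType) (a b : {set I}) := (a :\: b) :|: (b :\: a).

Lemma symdiff_inj (I : finType) (a : {set I}) : injective (symdiff a).
Proof.
move=> b c /setP e; apply/setP => i; move: (e i); rewrite !inE.
by case: (i \in a) (i \in b) (i \in c) => [] [] [].
Qed.

(* Each fibre of [f] lies in a Hamming ball, so there must be many fibres. *)
Lemma card_codomain_small_fibres (I T : finType) (f : {set I} -> T) r :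
  (forall a b, f a = f b -> #|symdiff a b| <= r) ->
  3 ^ (#|I| - r) <= #|T| * 2 ^ #|I|.
Proof.
move=> fr; rewrite -(@leq_pmul2l (2 ^ #|I|)) ?expn_gt0 //.
have -> : 2 ^ #|I| * (#|T| * 2 ^ #|I|) = #|T| * 4 ^ #|I|.
  by rewrite mulnCA -expnMn.
have -> : 2 ^ #|I| = \sum_(t : T) #|[set a | f a == t]|.
  rewrite -cardsT -card_powerset powersetT -sum1_card (partition_big f predT) //=.
  by apply: eq_bigr => t _; rewrite sum1dep_card;
    apply: eq_card => a; rewrite !inE.
rewrite big_distrl /= -sum_nat_const; apply: leq_sum => t _.
have [->|[a]] := set_0Vmem [set a | f a == t]; first by rewrite cards0.
rewrite inE => /eqP fa.
rewrite -(card_imset _ (@symdiff_inj _ a)); apply: card_hamming_ball => z.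
by move=> /imsetP[b]; rewrite inE => /eqP fb ->; apply: fr; rewrite fa fb.
Qed.

(** Take eighth powers and use [2 ^ 8 <= 3 ^ 6]; comparing exponents of 3 leaves
    [2 N <= 8 c + 8 r]. *)
Lemma exp3_gap N r c : 8 * r <= N -> 3 ^ (N - r) <= 3 ^ c * 2 ^ N -> N <= 8 * c.
Proof.
move=> rN; rewrite -(@leq_exp2r _ _ 8) // expnMn -!expnM (mulnC N 8) (expnM 2 8 N).
have h : (2 ^ 8) ^ N <= 3 ^ (6 * N).
  by case: N {rN} => // N; rewrite (expnM 3) leq_exp2r.
move=> /leq_trans /(_ (leq_mul (leqnn _) h)).
by rewrite -expnD leq_exp2l //; lia.
Qed.

(** Since [onth] is [None] past the end, a bounded message, length included, is encoded by finitely
    many values in [option bool]. *)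
Lemma onth_ord_inj M (s s' : seq bool) : size s <= M -> size s' <= M ->
  (forall i : 'I_M, onth s i = onth s' i) -> s = s'.
Proof.
elim: M s s' => [|M IH] [|x s] [|y s'] //= hs hs' e.
- by have := e ord0.
- by have := e ord0.
have [->] := e ord0; congr cons; apply: IH => // i.
by have := e (lift ord0 i).
Qed.

(** * Executions: stability of outputs and splicing *)

Section Execution_facts.
Variables (ids : nat -> nat) (A : algorithm ids) (n : nat).

Lemma output_config_stable (G : network n (ids n)) t t' v :
  t <= t' -> output (config A G t v) <> None ->
  output (config A G t' v) = output (config A G t v).
Proof.
move=> /subnKC <-; move: (t' - t) => d; case E: (output _) => [o|//] _.
by elim: d => [|d IH]; rewrite ?addn0 // addnS /=; apply: output_final.
Qed.

Lemma all_output_mono (G : network n (ids n)) t t' :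
  t <= t' -> all_output A G t -> all_output A G t'.
Proof. by move=> tt' h v; rewrite (output_config_stable tt'). Qed.

Lemma output_edges_stable (G : network n (ids n)) t t' :
  t <= t' -> all_output A G t -> output_edges A G t' = output_edges A G t.
Proof.
move=> tt' h; apply/setP => e; rewrite !inE /vertex_output.
by rewrite !(output_config_stable tt').
Qed.

Section Splice.
Variables (G1 G2 G3 : network n (ids n)) (S : pred 'I_n) (T : nat).
Hypothesis vid31 : vid G3 =1 vid G1.
Hypothesis vid32 : vid G3 =1 vid G2.
Hypothesis edges31 : forall u v, S u || S v ->
  ((u, v) \in edges G3) = ((u, v) \in edges G1).
Hypothesis edges32 : forall u v, ~~ (S u && S v) ->
  ((u, v) \in edges G3) = ((u, v) \in edges G2).
Hypothesis messages12 : forall t u v, t < T -> adjacent G3 u v -> S u != S v ->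
  send (config A G1 t u) (vid G3 v) = send (config A G2 t u) (vid G3 v).

(** By induction on rounds: a vertex has the same incident edges as in the run of its own side,
    messages from that side agree by induction, and messages across the cut are the same in both
    runs. *)
Lemma config_splice t v : t <= T ->
  config A G3 t v = if S v then config A G1 t v else config A G2 t v.
Proof.
elim: t v => [|t IH] v tT /=.
  rewrite /incident_edges; case: ifP => Sv; [rewrite vid31|rewrite vid32].
    congr (init _ _ (_, _)); rewrite (eq_imset _ vid31);
      apply: (congr1 (fun X : {set _} => imset _ (mem X)));
      by apply/setP => u; rewrite !inE edges31 // Sv ?orbT.
  congr (init _ _ (_, _)); rewrite (eq_imset _ vid32);
      apply: (congr1 (fun X : {set _} => imset _ (mem X)));
    by apply/setP => u; rewrite !inE edges32 // Sv ?andbF.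
have {}IH u := IH u (ltnW tT).
rewrite IH; case: ifP => Sv; congr receive; apply: funext => i.
  rewrite (@eq_pick _ _ (fun u => (vid G1 u == i) && adjacent G1 u v)); last first.
    by move=> u /=; rewrite vid31 /adjacent !edges31 ?Sv ?orbT.
  case: pickP => // u /andP[_ adj]; rewrite IH vid31; case: ifP => Su //.
  rewrite -vid31 -messages12 // ?Su ?Sv //.
  by move: adj; rewrite /adjacent !edges31 ?Sv ?orbT.
rewrite (@eq_pick _ _ (fun u => (vid G2 u == i) && adjacent G2 u v)); last first.
  by move=> u /=; rewrite vid32 /adjacent !edges32 ?Sv ?andbF.
case: pickP => // u /andP[_ adj]; rewrite IH vid32; case: ifP => Su //.
rewrite -vid32 messages12 // ?Su ?Sv //.
by move: adj; rewrite /adjacent !edges32 ?Sv ?andbF.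
Qed.

Lemma all_output_splice :
  all_output A G1 T -> all_output A G2 T -> all_output A G3 T.
Proof. by move=> h1 h2 v; rewrite config_splice //; case: ifP. Qed.

Lemma output_edges_splice u v : S u -> S v ->
  ((u, v) \in output_edges A G3 T) = ((u, v) \in output_edges A G1 T).
Proof.
by move=> Su Sv; rewrite !inE /vertex_output /= !config_splice // Su Sv !vid31.
Qed.

End Splice.
End Execution_facts.

(** Turns the approximation guarantee into a bound against any explicit spanner. *)
Lemma min_spanner_exists n k (E H : edge_set n) : is_spanner k E H ->
  exists2 Hmin, is_min_spanner k E Hmin & #|Hmin| <= #|H|.
Proof.
move=> /asboolP sH.
case: (@arg_minnP _ H (fun H' => `[< is_spanner k E H' >])
         (fun H' : edge_set n => #|H'|) sH) => H0 /asboolP sH0 minH0.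
by exists H0; [split=> // H' /asboolP|]; apply: minH0.
Qed.

(* The vertices [P i s] and [Q j t] span the dense bipartite part; Alice owns
   [P], [Q], [X1], [Y1] and Bob owns [X2], [Y2]. *)
Inductive role (l b : nat) :=
  | P of 'I_l & 'I_b | Q of 'I_l & 'I_b
  | X1 of 'I_l | Y1 of 'I_l | X2 of 'I_l | Y2 of 'I_l.
Arguments P {l b}. Arguments Q {l b}.
Arguments X1 {l b}. Arguments Y1 {l b}. Arguments X2 {l b}. Arguments Y2 {l b}.

Section Role_finite.
Variables l b : nat.

Definition role_code (w : role l b) :
    ('I_l * 'I_b + 'I_l * 'I_b) + (('I_l + 'I_l) + ('I_l + 'I_l)) :=
  match w with
  | P i s => inl (inl (i, s)) | Q i s => inl (inr (i, s))
  | X1 i => inr (inl (inl i)) | Y1 i => inr (inl (inr i))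
  | X2 i => inr (inr (inl i)) | Y2 i => inr (inr (inr i))
  end.

Definition role_decode
    (x : ('I_l * 'I_b + 'I_l * 'I_b) + (('I_l + 'I_l) + ('I_l + 'I_l))) :
    role l b :=
  match x with
  | inl (inl (i, s)) => P i s | inl (inr (i, s)) => Q i s
  | inr (inl (inl i)) => X1 i | inr (inl (inr i)) => Y1 i
  | inr (inr (inl i)) => X2 i | inr (inr (inr i)) => Y2 i
  end.

Lemma role_codeK : cancel role_code role_decode.
Proof. by case. Qed.

HB.instance Definition _ := Countable.copy (role l b) (can_type role_codeK).
HB.instance Definition _ : isFinite (role l b) := CanIsFinite role_codeK.

Lemma card_role : #|{: role l b}| = 2 * (l * b) + 4 * l.
Proof.
rewrite (bij_eq_card (f := role_code)) ?card_sum ?card_prod ?card_sum ?card_ord.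
  by lia.
by exists role_decode; [exact: role_codeK | case=> [[[]|[]]|[[]|[]]]].
Qed.

End Role_finite.

Lemma widen_ord_inj m n (mn : m <= n) : injective (widen_ord mn).
Proof. by move=> u v /(congr1 val) /= /val_inj. Qed.

(** * The gadget graph, its cut and its spanners *)

Section Gadget.
Variables l b n : nat.

Local Notation role := (role l b).
Local Notation input := {set 'I_l * 'I_l}.

Variable vertex : role -> 'I_n.
Hypothesis vertex_inj : injective vertex.

Definition role_edge (a a' : input) (w w' : role) : bool :=
  match w, w' with
  | P _ _, Q _ _ => true
  | P i _, X1 i' => i == i'
  | Y1 j, Q j' _ => j == j'
  | X1 i, X2 i' => i == i'
  | Y2 j, Y1 j' => j == j'
  | X1 i, Y1 j => (i, j) \notin a
  | X2 i, Y2 j => (i, j) \notin a'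
  | _, _ => false
  end.

Definition gadget_edges a a' : edge_set n :=
  [set (vertex w.1, vertex w.2) | w in [set w | role_edge a a' w.1 w.2]].

Lemma vertex_edge a a' w w' :
  ((vertex w, vertex w') \in gadget_edges a a') = role_edge a a' w w'.
Proof.
apply/imsetP/idP => [[[x x']]|e]; last by exists (w, w'); rewrite ?inE.
by rewrite inE /= => e [/vertex_inj -> /vertex_inj ->].
Qed.

Lemma gadget_edgeP a a' u v : (u, v) \in gadget_edges a a' ->
  exists w w', [/\ u = vertex w, v = vertex w' & role_edge a a' w w'].
Proof. by case/imsetP=> -[w w']; rewrite inE => e [-> ->]; exists w, w'. Qed.

Lemma gadget_irrefl a a' v : (v, v) \notin gadget_edges a a'.
Proof.
by apply/negP => /gadget_edgeP[w [w' [-> /vertex_inj <-]]]; case: w.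
Qed.

Definition gadget m (nm : n <= m) a a' : network n m :=
  Network (gadget_irrefl a a') (@widen_ord_inj _ _ nm).

Definition bob : {set 'I_n} :=
  [set v | [exists i, (v == vertex (X2 i)) || (v == vertex (Y2 i))]].

Lemma vertex_bob w :
  (vertex w \in bob) = match w with X2 _ | Y2 _ => true | _ => false end.
Proof.
rewrite inE; apply/existsP/idP => [[i /orP[]/eqP/vertex_inj ->]//|].
by case: w => // i _; exists i; rewrite eqxx ?orbT.
Qed.

(** Only edges from [X2] to [Y2] depend on Bob's input, and both their ends are Bob's. *)
Lemma gadget_edges_alice a1 a1' a2' u v : (u \notin bob) || (v \notin bob) ->
  ((u, v) \in gadget_edges a1 a1') = ((u, v) \in gadget_edges a1 a2').
Proof.
move=> h; apply/idP/idP => /gadget_edgeP[w [w' [eu ev]]]; move: h;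
  by rewrite eu ev !vertex_bob vertex_edge; case: w {eu}; case: w' {ev}.
Qed.

Lemma gadget_edges_bob a1 a2 a' u v : ~~ ((u \notin bob) && (v \notin bob)) ->
  ((u, v) \in gadget_edges a1 a') = ((u, v) \in gadget_edges a2 a').
Proof.
move=> h; apply/idP/idP => /gadget_edgeP[w [w' [eu ev]]]; move: h;
  by rewrite eu ev !vertex_bob vertex_edge; case: w {eu}; case: w' {ev}.
Qed.

(** Indexes the message channels between Alice and Bob: [2 l] edges, each in both directions, [fwd]
    being the direction of the edge itself. *)
Definition cut (c : 'I_l * bool * bool) : 'I_n * 'I_n :=
  let: (i, x, fwd) := c in
  let: (u, v) := if x then (vertex (X1 i), vertex (X2 i))
                 else (vertex (Y2 i), vertex (Y1 i)) in
  if fwd then (u, v) else (v, u).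

Lemma cutP m (nm : n <= m) a a' u v : adjacent (gadget nm a a') u v ->
  (u \notin bob) != (v \notin bob) -> exists c, cut c = (u, v).
Proof.
by case/orP => /gadget_edgeP[w [w' [-> ->]]]; rewrite !vertex_bob;
  case: w; case: w' => //= i j /eqP -> _;
  do [by exists (i, true, true) | by exists (i, true, false)
     | by exists (i, false, true) | by exists (i, false, false)].
Qed.

Lemma cut_adjacent m (nm : n <= m) a a' c :
  adjacent (gadget nm a a') (cut c).1 (cut c).2.
Proof.
by case: c => [[i []] []]; rewrite /adjacent /= !vertex_edge /= eqxx ?orbT.
Qed.

Definition sparse_edges a a' : edge_set n :=
  [set e in gadget_edges a a' |
     ~~ [exists i, exists s, exists j, exists t,
          e == (vertex (P i s), vertex (Q j t))]].

(** Lists every sparse edge possible for some input, so the size of the domain bounds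
    [#|sparse_edges a a'|]. *)
Definition sparse_code
    (x : ('I_l * 'I_b + 'I_l * 'I_b) +
         (('I_l + 'I_l) + ('I_l * 'I_l + 'I_l * 'I_l))) : 'I_n * 'I_n :=
  match x with
  | inl (inl (i, s)) => (vertex (P i s), vertex (X1 i))
  | inl (inr (i, s)) => (vertex (Y1 i), vertex (Q i s))
  | inr (inl (inl i)) => (vertex (X1 i), vertex (X2 i))
  | inr (inl (inr i)) => (vertex (Y2 i), vertex (Y1 i))
  | inr (inr (inl (i, j))) => (vertex (X1 i), vertex (Y1 j))
  | inr (inr (inr (i, j))) => (vertex (X2 i), vertex (Y2 j))
  end.

Lemma card_sparse_edges a a' :
  #|sparse_edges a a'| <= 2 * (l * b) + 2 * l + 2 * (l * l).
Proof.
have sub : sparse_edges a a' \subset [set sparse_code x | x : _].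
  apply/subsetP => -[u v]; rewrite inE => /andP[/gadget_edgeP[w [w' [-> ->]]]].
  case: w => [i s|i s|i|i|i|i]; case: w' => [j t|j t|j|j|j|j] //=.
  - by move=> _ /existsP[]; exists i; apply/existsP; exists s; apply/existsP;
      exists j; apply/existsP; exists t.
  - by move=> /eqP <- _; apply/imsetP; exists (inl (inl (i, s))).
  - by move=> _ _; apply/imsetP; exists (inr (inr (inl (i, j)))).
  - by move=> /eqP <- _; apply/imsetP; exists (inr (inl (inl i))).
  - by move=> /eqP <- _; apply/imsetP; exists (inl (inr (i, t))).
  - by move=> _ _; apply/imsetP; exists (inr (inr (inr (i, j)))).
  - by move=> /eqP <- _; apply/imsetP; exists (inr (inl (inr i))).
apply: leq_trans (subset_leq_card sub) _; apply: leq_trans (leq_imset_card _ _) _.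
by rewrite !card_sum !card_prod !card_ord; lia.
Qed.

(** The detour from [P i s] to [Q j t] has length 3 through Alice's bit edge; if [(i, j)] is in [a],
    disjointness supplies Bob's bit edge and a detour of length 5, whence [5 <= k]. *)
Lemma sparse_edges_spanner k (a a' : input) : 5 <= k -> [disjoint a & a'] ->
  is_spanner k (gadget_edges a a') (sparse_edges a a').
Proof.
move=> k5 dis; split; first by apply/subsetP => e; rewrite inE => /andP[].
have sp w w' : role_edge a a' w w' ->
    match w, w' with P _ _, Q _ _ => false | _, _ => true end ->
    (vertex w, vertex w') \in sparse_edges a a'.
  rewrite inE vertex_edge => -> /= nPQ; apply/negP.
  case/existsP => i /existsP[s /existsP[j /existsP[t /eqP[]]]].
  by move=> /vertex_inj ew /vertex_inj ew'; rewrite ew ew' in nPQ.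
move=> u v /[dup] uv /gadget_edgeP[w [w' [eu ev]]].
have [uvS _|] := boolP ((u, v) \in sparse_edges a a').
  by exists [:: v]; rewrite /= uvS; split=> //; lia.
rewrite inE uv negbK /= => /existsP[i /existsP[s /existsP[j /existsP[t]]]].
case/eqP=> -> -> _.
have [ija|ija] := boolP ((i, j) \in a).
  have ija' : (i, j) \notin a' by rewrite (disjointFr dis).
  exists [seq vertex w | w <- [:: X1 i; X2 i; Y2 j; Y1 j; Q j t]].
  by split; rewrite //= !sp //= eqxx.
exists [seq vertex w | w <- [:: X1 i; Y1 j; Q j t]].
by split; [rewrite /= !sp /= ?eqxx | | rewrite /=; lia].
Qed.

(* Without the edge itself, the vertices that can be reached from [P i s] are
   [X1 i], [X2 i], and vertices [Y1 j'], [Y2 j'], [Q j' t'] other than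
   [Y1 j], [Y2 j] and [Q j t]. *)
Lemma conflict_edge_spanner k (a a' : input) H i j s t :
  is_spanner k (gadget_edges a a') H ->
  (i, j) \in a -> (i, j) \in a' -> (vertex (P i s), vertex (Q j t)) \in H.
Proof.
move=> [/subsetP HE span] ija ija'; apply/negPn/negP => nH.
have [|p [pH lp _]] := span (vertex (P i s)) (vertex (Q j t)).
  by rewrite vertex_edge.
pose ok w := match w with
  | P i' s' => (i' == i) && (s' == s) | X1 i' | X2 i' => i' == i
  | Y1 j' | Y2 j' => j' != j | Q j' t' => (j', t') != (j, t) end.
have : exists2 w, last (vertex (P i s)) p = vertex w & ok w; last first.
  by rewrite lp => -[w /vertex_inj <-]; rewrite /= eqxx.
have {lp} : exists2 w, vertex (P i s) = vertex w & ok w.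
  by exists (P i s); rewrite //= !eqxx.
elim: p (vertex _) pH => [//|v p IH] u /= /andP[uvH /IH{}IH] [w eu okw].
apply: IH; have /gadget_edgeP[x [w' [ew ev e]]] := HE _ uvH; subst v.
rewrite ew in eu; move/vertex_inj in eu; subst x; exists w' => //.
move: okw e; case: w ew => [i0 s0|i0 s0|i0|i0|i0|i0] ew;
  case: w' uvH => [i1 s1|i1 s1|i1|i1|i1|i1] //= uvH.
- move=> /andP[/eqP i0i /eqP s0s] _; apply: contraNneq nH => -[<- <-].
  by rewrite -i0i -s0s -ew.
- by move=> /andP[/eqP <- _] /eqP <-.
- by move=> /eqP ->; apply: contraNneq => ->.
- by move=> /eqP <- /eqP <-.
- by move=> ne /eqP <-; apply: contraNneq ne => -[->].
- by move=> /eqP ->; apply: contraNneq => ->.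
- by move=> ne /eqP <-.
Qed.

(** In the application [H] is the output on a spliced input and [D] that of an original run;
    splicing makes them agree on [P] x [Q]. *)
Lemma card_conflicts_spanner k (a a' : input) H (D : edge_set n) :
  is_spanner k (gadget_edges a a') H ->
  (forall i j s t, (vertex (P i s), vertex (Q j t)) \in H ->
                   (vertex (P i s), vertex (Q j t)) \in D) ->
  #|a :&: a'| * b ^ 2 <= #|D|.
Proof.
move=> spH HD.
pose f (x : ('I_l * 'I_l) * ('I_b * 'I_b)) :=
  (vertex (P x.1.1 x.2.1), vertex (Q x.1.2 x.2.2)).
have f_inj : injective f.
  by case=> [[i j] [s t]] [[i' j'] [s' t']] [/vertex_inj[-> ->] /vertex_inj[-> ->]].
have -> : #|a :&: a'| * b ^ 2 =
    #|[set f x | x in setX (a :&: a') [set: 'I_b * 'I_b]]|.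
  by rewrite card_imset // cardsX cardsT card_prod card_ord.
apply/subset_leq_card/subsetP => _ /imsetP[[[i j] [s t]] xin ->].
move: xin; rewrite !inE andbT => /andP[ija ija']; apply: HD.
exact: (conflict_edge_spanner _ _ spH).
Qed.

End Gadget.

(** * The lower bound on rounds *)

Lemma role_embedding l b n : 2 * (l * b) + 4 * l <= n ->
  exists vertex : role l b -> 'I_n, injective vertex.
Proof.
rewrite -card_role => fits; exists (fun w => widen_ord fits (enum_rank w)).
by move=> w w' /widen_ord_inj /enum_rank_inj.
Qed.

Lemma gadget_rounds (R : realType) k (ids : nat -> nat) (A : algorithm ids)
    (alpha : nat -> R) l b n M :
  5 <= k -> n <= ids n -> approximates_spanner k alpha A ->
  2 * (l * b) + 4 * l <= n -> 0 < l ->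
  (forall (G : network n (ids n)) t u v, adjacent G u v ->
     size (send (config A G t u) (vid G v)) <= M) ->
  (0 < alpha n)%R ->
  (16 * alpha n * (2 * (l * b) + 2 * l + 2 * (l * l))%:R <=
   ((l * b) ^ 2)%:R)%R ->
  exists (G : network n (ids n)) t, takes_rounds A G t /\ l <= 32 * (t * M).
Proof.
move=> k5 nids approx /role_embedding[vertex vinj] l0 hM al0 hal.
pose N := gadget vinj nids.
pose run a := N a (~: a).
have [tm tmP] := choice (fun a => approx n (run a)).
(* A time by which all runs have output, attained by one of them; [set0] only witnesses that inputs
   exist. *)
pose T := tm [arg max_(a > set0) tm a].
have tmT a : tm a <= T.
  by rewrite /T; case: arg_maxnP => // a0 _; apply.
exists (run [arg max_(a > set0) tm a]), T; split.
  by case: (tmP [arg max_(a > set0) tm a]).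
pose tr (a : {set 'I_l * 'I_l}) :
    {ffun 'I_T * ('I_l * bool * bool) * 'I_M -> option bool} :=
  [ffun x : 'I_T * ('I_l * bool * bool) * 'I_M =>
   onth (send (config A (run a) x.1.1 (cut vertex x.1.2).1)
              (vid (run a) (cut vertex x.1.2).2)) x.2].
have allT a : all_output A (run a) T.
  by apply: all_output_mono (tmT a) _; case: (tmP a) => -[].
have disC (a : {set 'I_l * 'I_l}) : [disjoint a & ~: a].
  by rewrite -setI_eq0 setICr.
have fibre a c : tr a = tr c ->
    ((#|a :\: c| * b ^ 2)%:R <=
     alpha n * (2 * (l * b) + 2 * l + 2 * (l * l))%:R)%R.
  move=> /ffunP tac.
  have msg t u v : t < T -> adjacent (N a (~: c)) u v ->
      (u \notin bob vertex) != (v \notin bob vertex) ->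
      send (config A (run a) t u) (vid (N a (~: c)) v) =
      send (config A (run c) t u) (vid (N a (~: c)) v).
    move=> tT adj uv; have [x ex] := cutP adj uv.
    have ea := cut_adjacent vinj nids a (~: a) x.
    have ec := cut_adjacent vinj nids c (~: c) x.
    rewrite ex /= in ea ec.
    apply: (onth_ord_inj (hM _ _ _ _ ea) (hM _ _ _ _ ec)) => i.
    by have := tac (Ordinal tT, x, i); rewrite !ffunE /= ex.
  pose alice u := u \notin bob vertex.
  have e31 u v : alice u || alice v ->
      ((u, v) \in edges (N a (~: c))) = ((u, v) \in edges (run a)).
    exact: gadget_edges_alice.
  have e32 u v : ~~ (alice u && alice v) ->
      ((u, v) \in edges (N a (~: c))) = ((u, v) \in edges (run c)).
    exact: gadget_edges_bob.
  have allT' : all_output A (N a (~: c)) T.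
    exact: (@all_output_splice _ _ _ (run a) (run c) _ alice).
  have out_splice := @output_edges_splice _ A _ (run a) (run c) (N a (~: c))
    alice T (fun=> erefl) (fun=> erefl) e31 e32 msg.
  have [t [[all_t min_t] _ [sp _]]] := approx n (N a (~: c)).
  have [[all_a _] _ [_ apx]] := tmP a.
  have sparse_sp := sparse_edges_spanner vinj k5 (disC a).
  have [Hmin minH leH] := min_spanner_exists sparse_sp.
  apply: le_trans (_ : #|output_edges A (run a) (tm a)|%:R <= _)%R.
    rewrite ler_nat setDE; apply: (card_conflicts_spanner vinj sp) => i j s t'.
    (* The spliced run may finish before [T]; outputs being final, its edges can be read at time
       [T]. *)
    rewrite -(output_edges_stable (min_t _ allT') all_t).
    by rewrite out_splice /alice ?(vertex_bob vinj) //
      (output_edges_stable (tmT a) all_a).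
  apply: le_trans (apx _ minH) _; apply: ler_wpM2l; first exact: ltW.
  by rewrite ler_nat (leq_trans leH) // card_sparse_edges.
have tr_fibres a c : tr a = tr c -> #|symdiff a c| <= (l * l) %/ 8.
  move=> tac; have h1 := fibre a c tac; have h2 := fibre c a (esym tac).
  (* For [b = 0] the right side of [hal] vanishes while the left is positive. *)
  have b0 : 0 < b.
    rewrite lt0n; apply/eqP => b0; move: hal.
    by rewrite b0 muln0 leNgt !mulr_gt0 // ltr0n; lia.
  rewrite leq_divRL // -(@leq_pmul2r (b ^ 2)) ?expn_gt0 ?b0 //.
  have -> : l * l * b ^ 2 = (l * b) ^ 2 by rewrite expnMn.
  have hU : #|symdiff a c| <= #|a :\: c| + #|c :\: a|.
    by rewrite /symdiff cardsU leq_subr.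
  (* The 16 in [hal] is 8 for the radius times 2 for the two one-sided differences. *)
  rewrite -(ler_nat R); apply: le_trans hal; apply: le_trans
    (_ : (8 * (#|a :\: c| * b ^ 2 + #|c :\: a| * b ^ 2))%:R <= _)%R.
    by rewrite ler_nat -mulnDl -mulnA mulnCA leq_mul2l leq_mul2r hU !orbT.
  by rewrite natrM natrD; lra.
have := card_codomain_small_fibres tr_fibres.
rewrite card_ffun !card_prod !card_ord card_option card_bool.
(* There are [3 ^ (4 l T M)] transcripts, so [exp3_gap] gives [l ^ 2 <= 32 l T M]. *)
move=> /exp3_gap; have -> : 8 * (l * l %/ 8) <= l * l by lia.
move=> /(_ isT) h.
have : l * l <= l * (32 * (T * M)) by lia.
by rewrite leq_pmul2l.
Qed.

(** * Choice of parameters and asymptotics *)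

Local Open Scope ring_scope.

Lemma gadget_parameters (R : realType) (a : R) n : 1 <= a <= n%:R / 700 ->
  exists l b : nat, [/\ (2 * (l * b) + 4 * l <= n)%N, (0 < l)%N,
    16 * a * (2 * (l * b) + 2 * l + 2 * (l * l))%:R <= ((l * b) ^ 2)%:R
  & n%:R <= 132 * (l%:R * Num.sqrt a)].
Proof.
case/andP=> a1 an; have a0 : 0 <= a by lra.
set r := Num.sqrt a.
have r2 : r ^+ 2 = a by apply: sqr_sqrtr.
have r0 : 0 <= r by apply: sqrtr_ge0.
have r1 : 1 <= r by rewrite -sqrtr1 ler_sqrt.
(* [b] lies between [10 r] and [11 r], so [b ^ 2 >= 100 a]; [6 * b] comes from
   [2 l b + 4 l <= 6 l b]. *)
pose b := (Num.truncn (10 * r)).+1; pose l := (n %/ (6 * b))%N.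
have /andP[bl bu] : (Num.truncn (10 * r))%:R <= 10 * r < b%:R.
  by apply: truncn_itv; lra.
have {bl} bu' : b%:R <= 11 * r by rewrite /b -natr1; lra.
have ln_le : (6 * (l * b) <= n)%N by rewrite /l mulnCA leq_trunc_div.
have ln_gt : (n < 6 * (l * b) + 6 * b)%N.
  by have := ltn_ceil n (isT : (0 < 6 * b)%N); rewrite -/l; lia.
move: ln_gt; rewrite -(ltr_nat R) natrD !natrM => ln_gt.
have ra : r <= a by nra.
(* From [n >= 700 a] and [n < 6 l b + 6 b]: [l b] exceeds [700 a / 6 - 11 a]. *)
have lb : 100 * a <= l%:R * b%:R by lra.
have l0 : (0 < l)%N.
  rewrite lt0n; apply/eqP => l0; rewrite l0 mul0r in lb; lra.
have l1 : 1 <= l%:R :> R by rewrite ler1n.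
exists l, b; split=> //.
  apply: leq_trans ln_le; rewrite [leqRHS](mulnDl 2 4) leq_add2l leq_mul2l.
  by rewrite leq_pmulr.
  rewrite natrX !(natrD, natrM).
  have b2 : 100 * a <= b%:R ^+ 2 by nra.
  move: lb b2 l1; set x := l%:R; set y := b%:R => lb b2 l1.
  have h1 : 100 * a * (x * y) <= (x * y) ^+ 2.
    by rewrite expr2 ler_wpM2r //; nra.
  have h2 : 100 * a * x ^+ 2 <= (x * y) ^+ 2.
    by rewrite exprMn mulrC ler_wpM2l // sqr_ge0.
  have h3 : a * x <= a * (x * y) by rewrite ler_wpM2l // ler_peMr //; lra.
  (* The terms in [l b] and [l] take at most 64/100 of the right side, the term in [l ^ 2] at most
     32/100. *)
  by nra.
(* Here [n < 6 b (l + 1) <= 66 r (l + 1) <= 132 r l]. *)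
nra.
Qed.

Theorem theorem11 (R : realType) :
  exists c' : R, 1 < c' /\
  forall (k : nat), (5 <= k)%N ->
  forall (alpha : nat -> R), is_ratio alpha ->
  forall (ids : nat -> nat), (forall n, (n <= ids n)%N) ->
  forall (A : algorithm ids),
    is_congest R A -> approximates_spanner k alpha A ->
  exists (c : R) (n0 : nat), 0 < c /\
    forall n : nat, (n0 <= n)%N -> 1 <= alpha n <= n%:R / c' ->
    exists (G : network n (ids n)) (t : nat),
      takes_rounds A G t /\
      c * (n%:R / (Num.sqrt (alpha n) * ln n%:R)) <= t%:R.
Proof.
exists 700; split=> [|k k5 alpha _ ids nids A [B [n0 congest]] approx].
  by lra.
(* [B] could be nonpositive; [B'] keeps the final constant positive. *)
pose B' := Num.max B 1.
have B'1 : 1 <= B' by rewrite le_max lexx orbT.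
(* [4224 = 132 * 32] combines [n <= 132 l r], with [r] the root of [alpha n], and [l <= 32 t M];
   [n >= 2] makes [ln n] positive. *)
exists (4224 * B')^-1, (maxn n0 2); split=> [|n]; first by rewrite invr_gt0; lra.
rewrite geq_max => /andP[n0n n2] an; have /andP[a1 _] := an.
have [l [b [fits l0 gap nl]]] := gadget_parameters an.
have L0 : 0 < ln n%:R :> R by rewrite ln_gt0 // ltr1n.
have BL0 : 0 <= B' * ln n%:R by nra.
pose M := Num.truncn (B' * ln n%:R).
have msgM (G : network n (ids n)) t u v : adjacent G u v ->
    (size (send (config A G t u) (vid G v)) <= M)%N.
  move=> adj; rewrite /M truncn_ge_nat //.
  apply: le_trans (congest _ n0n _ _ _ _ adj) _.
  by apply: ler_wpM2r; [exact: ltW | rewrite le_max lexx].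
have al0 : 0 < alpha n by lra.
have [G [t [Gt lt]]] := gadget_rounds k5 (nids n) approx fits l0 msgM al0 gap.
exists G, t; split=> //.
have r0 : 0 < Num.sqrt (alpha n) by rewrite sqrtr_gt0; lra.
rewrite mulrA ler_pdivrMr ?mulr_gt0 // mulrC ler_pdivrMr; last by lra.
have ML : M%:R <= B' * ln n%:R by rewrite truncn_le.
move: lt; rewrite -(ler_nat R) !natrM => lt.
have tM : t%:R * M%:R <= t%:R * (B' * ln n%:R) by rewrite ler_wpM2l.
apply: le_trans nl _.
have -> : t%:R * (Num.sqrt (alpha n) * ln n%:R) * (4224 * B') =
  132 * ((32 * (t%:R * (B' * ln n%:R))) * Num.sqrt (alpha n)) by ring.
by rewrite ler_wpM2l // ler_wpM2r //; lra.
Qed.
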